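(* Let $n\in\mathbb{N}$, $T>0$, let $\Omega\subset\mathbb{R}^n$ be compact, and let $\sigma:\mathbb{R}\to\mathbb{R}$ be non-polynomial and Lipschitz continuous (and the derivative of a differentiable function $\tilde\sigma:\mathbb{R}\to\mathbb{R}$). Then for every $f\in\mathcal{C}(\Omega;\mathbb{R}^n)$ and every $\varepsilon>0$ there exist $N\in\mathbb{N}$ and weights $\theta_j=\{J_j,W_j,b_j,\eta_j\}$, $j=0,\dots,N-1$, of the $N$-layer Hamiltonian deep neural network (HDNN) with step size $h=T/N$, for which the flow of the HDNN is well defined, such that the restricted flow $\varphi:\xi\mapsto q_N$, where $(p_N,q_N)$ is the solution at step $N$ of the HDNN with initial condition $(p_0,q_0)=(\xi,0_n)$, satisfies $$\sup_{\xi\in\Omega}\|f(\xi)-\varphi(\xi)\|\le\varepsilon .$$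
   Context: $\|\cdot\|$ is the Euclidean norm, $0_n$ is the zero vector of $\mathbb{R}^n$, and $\mathcal{C}(\Omega;\mathbb{R}^n)$ is the space of continuous functions $\Omega\to\mathbb{R}^n$. A function is non-polynomial if it cannot be represented as a polynomial. HDNN. Given $N\in\mathbb{N}$, step size $h=T/N$, and weights $\theta_j=\{J_j,W_j,b_j,\eta_j\}$, $j=0,\dots,N-1$, with $J_j\in\mathbb{R}^{2n\times 2n}$ skew-symmetric ($J_j=-J_j^\top$), $W_j\in\mathbb{R}^{2n\times 2n}$, $b_j\in\mathbb{R}^{2n}$, $\eta_j\in\mathbb{R}^{2n}$, the HDNN is the (in general implicit) discrete-time system, with $p_j,q_j\in\mathbb{R}^n$, $$\begin{bmatrix}p_{j+1}\\ q_{j+1}\end{bmatrix}=\begin{bmatrix}p_j\\ q_j\end{bmatrix}+hJ_j\left(W_j^\top\sigma\left(W_j\begin{bmatrix}p_{j+1}\\ q_j\end{bmatrix}+b_j\right)+\eta_j\right),\qquad j=0,\dots,N-1,$$ where $\sigma$ is applied entrywise. The flow $\Phi_N:\mathbb{R}^{2n}\to\mathbb{R}^{2n}$ at time $N$ maps the initial condition $(p_0,q_0)$ to the corresponding unique solution $(p_N,q_N)$ at step $N$; the flow is well defined if this solution exists and is unique for every initial condition in $\mathbb{R}^{2n}$. *)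

(* Defs.v *)
From HB Require Import structures.
From mathcomp Require Import all_boot all_order all_algebra.
From mathcomp Require Import all_classical all_reals all_analysis.

Set Implicit Arguments.
Unset Strict Implicit.
Unset Printing Implicit Defensive.

Import Order.TTheory GRing.Theory Num.Theory.
Import numFieldNormedType.Exports.

Local Open Scope classical_set_scope.
Local Open Scope ring_scope.

(* The library norm `|v| on 'cV[R]_n is the sup norm. It induces the same
   topology as the Euclidean norm, so [compact] and [continuous] below are
   those of R^n, but the Euclidean norm itself has to be defined. *)
Definition enorm (R : realType) (n : nat) (v : 'cV[R]_n) : R :=
  Num.sqrt (\sum_(i < n) v i 0 ^+ 2).

Definition non_polynomial (R : realType) (sigma : R -> R) : Prop :=
  ~ exists P : {poly R}, forall x, sigma x = P.[x].

Definition lipschitz_continuous (R : realType) (sigma : R -> R) : Prop :=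
  exists k : R, k.-lipschitz sigma.

Record hdnn_layer (R : realType) (n : nat) := HdnnLayer {
  hdnn_J : 'M[R]_(n + n);
  hdnn_W : 'M[R]_(n + n);
  hdnn_b : 'cV[R]_(n + n);
  hdnn_eta : 'cV[R]_(n + n);
  hdnn_J_skew : hdnn_J = - hdnn_J^T
}.

(* One implicit layer, from z = (p_j, q_j) to z' = (p_{j+1}, q_{j+1}): the
   argument of sigma mixes the new p with the old q. *)
Definition hdnn_step (R : realType) (n : nat) (sigma : R -> R) (h : R)
    (th : hdnn_layer R n) (z z' : 'cV[R]_n * 'cV[R]_n) : Prop :=
  col_mx z'.1 z'.2 = col_mx z.1 z.2 +
    h *: (hdnn_J th *m
      ((hdnn_W th)^T *m
         map_mx sigma (hdnn_W th *m col_mx z'.1 z.2 + hdnn_b th)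
       + hdnn_eta th)).

(* [widen_ord (leqnSn N) j] and [lift ord0 j] are the indices j and j + 1
   in {0, ..., N}. *)
Definition hdnn_solution (R : realType) (n : nat) (sigma : R -> R) (h : R)
    (N : nat) (theta : 'I_N -> hdnn_layer R n) (z0 : 'cV[R]_n * 'cV[R]_n)
    (z : {ffun 'I_N.+1 -> 'cV[R]_n * 'cV[R]_n}) : Prop :=
  z ord0 = z0 /\
  forall j : 'I_N, hdnn_step sigma h (theta j)
    (z (widen_ord (leqnSn N) j)) (z (lift ord0 j)).

Definition hdnn_well_defined (R : realType) (n : nat) (sigma : R -> R) (h : R)
    (N : nat) (theta : 'I_N -> hdnn_layer R n) : Prop :=
  forall z0, exists! z, hdnn_solution sigma h theta z0 z.

(* [get] selects an element of a nonempty set and returns a default value on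
   the empty set; under [hdnn_well_defined] the set below is a singleton. *)
Definition hdnn_flow (R : realType) (n : nat) (sigma : R -> R) (h : R)
    (N : nat) (theta : 'I_N -> hdnn_layer R n) (z0 : 'cV[R]_n * 'cV[R]_n) :
    'cV[R]_n * 'cV[R]_n :=
  get [set zN | exists2 z, hdnn_solution sigma h theta z0 z & zN = z ord_max].

Definition hdnn_restricted_flow (R : realType) (n : nat) (sigma : R -> R)
    (h : R) (N : nat) (theta : 'I_N -> hdnn_layer R n) (xi : 'cV[R]_n) :
    'cV[R]_n :=
  (hdnn_flow sigma h theta (xi, 0)).2.

(* Main.v *)
(** A layer whose skew matrix only couples p to q, and whose sigma-term depends on
    p only, fixes p and adds c sigma(w.p + b) to q, for arbitrary c, w and b; it
    is in particular explicit.  Starting from (xi, 0), N such layers produce the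
    shallow network sum_j c_j sigma(w_j.xi + b_j), so it remains to see that these
    are dense in C(Omega), which is done in three steps.

    1. If sigma is not a polynomial, some k-th difference of sigma of step h is
    nonzero at some point, for each k.  The k-fold average G of sigma over
    translates in [0, h] is a uniform limit of combinations of translates of sigma,
    and its k-th derivative is, up to a factor, that difference.  Hence the k-th
    difference of G at x0 of step l t, divided by l^k, tends to a nonzero
    multiple of t^k as l tends to 0.

    2. By the exponential series, the functions x |-> exp (w.x) are then in the
    closure of the shallow networks.

    3. These exponentials span an algebra, whose closure contains the inverses of
    its positive elements, hence the softmax averages
    (sum_i f(x_i) E_i) / (sum_i E_i) with E_i = exp (beta (r_i^2 - |x - x_i|^2)).
    When the balls of radius r_i / 2 around x_i cover Omega and f oscillates little
    on those of radius r_i, such an average is close to f for large beta. *)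

Require Import Defs.
From HB Require Import structures.
From mathcomp Require Import all_boot all_order all_algebra.
From mathcomp Require Import all_classical all_reals all_analysis.
From mathcomp Require Import ring lra.

Set Implicit Arguments.
Unset Strict Implicit.
Unset Printing Implicit Defensive.

Import Order.TTheory GRing.Theory Num.Theory.
Import numFieldNormedType.Exports.
Local Open Scope classical_set_scope.
Local Open Scope ring_scope.

(** * Antiderivatives of continuous functions on the line *)

Section antiderivatives.
Variable R : realType.
Implicit Types (f g F : R -> R) (x y h u L : R).

Definition antiderivative F f := forall x : R, is_derive x 1 F (f x).

Lemma antiderivative_continuous F f : antiderivative F f -> continuous F.
Proof.
move=> Ff x; apply: differentiable_continuous; apply/derivable1_diffP.
by have [] := Ff x.
Qed.

Lemma antiderivative_MVT F f a b : antiderivative F f ->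
  exists2 c, `|c - a| <= `|b - a| & F b - F a = f c * (b - a).
Proof.
move=> Ff; have cF := antiderivative_continuous Ff.
have [ab|ba|->] := ltgtP a b; last by exists b; rewrite ?subrr ?mulr0.
- have [] := @MVT R F f a b ab (fun x _ => Ff x) (continuous_subspaceT cF).
  move=> c; rewrite in_itv /= => /andP[ac cb] e; exists c => //.
  by rewrite !gtr0_norm ?subr_gt0 // lerD2r ltW.
- have [] := @MVT R F f b a ba (fun x _ => Ff x) (continuous_subspaceT cF).
  move=> c; rewrite in_itv /= => /andP[bc ca] e; exists c.
    by rewrite !ltr0_norm ?subr_lt0 // lerN2 lerD2r ltW.
  by rewrite -opprB e -mulrN opprB.
Qed.

Lemma antiderivative_right f a : continuous f ->
  exists F, forall x, a < x -> is_derive x 1 F (f x).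
Proof.
move=> cf; exists (fun x => \int[lebesgue_measure]_(t in `[a, x]) f t) => x ax.
have [] := @continuous_FTC1_closed R f a x (x + 1) _ _ ax (cf x).
- by rewrite ltrDl.
- apply: continuous_compact_integrable; first exact: segment_compact.
  exact: continuous_subspaceT.
- by move=> dF <-; rewrite derive1E; exact: DeriveDef.
Qed.

(** The integral from -1 gives a primitive on x > -1, and its reflected version one on x < 1; on the
    overlap they differ by a constant, so they can be glued. *)
Lemma antiderivative_exists f : continuous f -> exists F, antiderivative F f.
Proof.
move=> cf.
have cN : continuous (f \o -%R).
  by move=> x; apply: continuous_comp; [exact: opp_continuous|exact: cf].
have [F1 dF1] := antiderivative_right (-1) cf.
have [H dH] := antiderivative_right (-1) cN.
pose F2 x := - H (- x).
have dF2 x : x < 1 -> is_derive x 1 F2 (f x).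
  move=> x1; have dHx : is_derive (- x) 1 H (f (- - x)).
    by apply: dH; rewrite ltrN2.
  have dHN := is_derive1_comp dHx (is_deriveNid x 1).
  apply: (is_derive_eq (is_deriveN dHN)).
  by rewrite mulrN1 !opprK.
pose c := F1 0 - F2 0.
have E x : -1 < x -> x < 1 -> F1 x = F2 x + c.
  move=> x1 x2; pose D := F1 - F2.
  have dD y : -1 < y -> y < 1 -> is_derive y 1 D 0.
    move=> y1 y2; have i1 := dF1 y y1; have i2 := dF2 y y2.
    by apply: is_derive_eq; exact: subrr.
  have cD y : -1 < y -> y < 1 -> {for y, continuous D}.
    move=> y1 y2; apply: differentiable_continuous; apply/derivable1_diffP.
    by have [] := dD y y1 y2.
  have key a b : -1 < a -> a < b -> b < 1 -> D a = D b.
    move=> a1 ab b1.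
    have [||z _] := @MVT R D (fun=> 0) a b ab.
    - move=> z; rewrite in_itv /= => /andP[z1 z2].
      by apply: dD; [exact: lt_trans z1|exact: lt_trans b1].
    - apply: continuous_in_subspaceT => z; rewrite inE /= in_itv /= => /andP[z1 z2].
      by apply: cD; [exact: lt_le_trans z1|exact: le_lt_trans b1].
    - by rewrite mul0r => /eqP; rewrite subr_eq0 => /eqP.
  have D0 : D x = D 0.
    have [x0|x0|-> //] := ltgtP x 0; first by apply: key => //; lra.
    by symmetry; apply: key => //; lra.
  have -> : c = D 0 by [].
  by rewrite -D0 /D /= !fctE; lra.
exists (fun x => if -1 < x then F1 x else F2 x + c) => x.
have [x0|x0] := ltP (-1) x.
  apply: near_eq_is_derive (dF1 x x0).
  by near=> y; rewrite ifT //; near: y; exact: lt_nbhsr.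
apply: (@near_eq_is_derive _ _ _ (fun y => F2 y + c)).
  near=> y; case: ifPn => // y1; rewrite E //.
  by near: y; apply: lt_nbhsl; lra.
have i2 : is_derive x 1 F2 (f x) by apply: dF2; lra.
by apply: is_derive_eq; rewrite addr0.
Unshelve. all: by end_near.
Qed.

End antiderivatives.

(** * Finite differences and the polynomials they annihilate *)

Section differences.
Variable R : realType.
Implicit Types (f g F : R -> R) (x y h u L : R) (p q : {poly R}).

Definition fdiff h f : R -> R := fun x => f (x + h) - f x.

Lemma antiderivative_fdiff F f h :
  antiderivative F f -> antiderivative (fdiff h F) (fdiff h f).
Proof.
move=> Ff x; have dFx : is_derive (shift h x) 1 F (f (shift h x)) by exact: Ff.
apply: (is_derive_eq (is_deriveB (is_derive1_comp dFx (is_derive_shift x 1 h))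
  (Ff x))).
by rewrite mulr1.
Qed.

Lemma antiderivative_iter_fdiff k F f h : antiderivative F f ->
  antiderivative (iter k (fdiff h) F) (iter k (fdiff h) f).
Proof. by move=> Ff; elim: k => //= k; exact: antiderivative_fdiff. Qed.

(** Differencing a tower of antiderivatives gives a tower again; each use of the mean value theorem
    trades one difference for a factor [u] and moves the point by at most |u|. *)
Lemma iter_fdiff_MVT k (F : nat -> R -> R) u x :
  (forall i, (i < k)%N -> antiderivative (F i.+1) (F i)) ->
  exists2 c, `|c - x| <= k%:R * `|u| &
    iter k (fdiff u) (F k) x = u ^+ k * F 0%N c.
Proof.
elim: k F => [|k IH] F dF.
  by exists x; rewrite ?subrr ?normr0 ?mul0r // expr0 mul1r.
rewrite iterSr; have [|c cx ->] := IH (fun i => fdiff u (F i.+1)).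
  by move=> i ik; apply: antiderivative_fdiff; exact: dF.
have [c' c'c E] := antiderivative_MVT c (c + u) (dF 0%N isT).
exists c'; last by rewrite /fdiff E [c + u]addrC addrK exprSr mulrAC mulrA.
move: c'c; rewrite [c + u]addrC addrK => c'c.
have -> : c' - x = (c' - c) + (c - x) by ring.
rewrite (le_trans (ler_normD _ _)) //.
by rewrite -natr1 mulrDl mul1r addrC lerD.
Qed.

Lemma iter_fdiffB k h f g x :
  iter k (fdiff h) (f - g) x = iter k (fdiff h) f x - iter k (fdiff h) g x.
Proof. by elim: k x => //= k IH x; rewrite /fdiff !IH; ring. Qed.

(** The derivatives of [p] form such a tower, whose bottom, the k-th derivative, is zero. *)
Lemma iter_fdiff_horner k p u x : (size p <= k)%N ->
  iter k (fdiff u) (horner p) x = 0.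
Proof.
move=> pk.
have [|c _] := @iter_fdiff_MVT k (fun i => horner p^`(k - i)) u x.
  by move=> i ik y; rewrite -(subnSK ik) derivnS; exact: is_derive_poly.
by rewrite subnn derivn0 subn0 derivn_poly0 // horner0 mulr0.
Qed.

(** By induction on [k], [fdiff h f] vanishes on the grid, so [f] is constant there, equal to its
    first value. *)
Lemma fdiff_grid0 k f h x : (forall y, iter k (fdiff h) f y = 0) ->
  (forall i, (i < k)%N -> f (x + i%:R * h) = 0) ->
  forall i, f (x + i%:R * h) = 0.
Proof.
elim: k f => [f f0 _ i|k IH f f0 g0 i]; first exact: f0.
have E j : x + j.+1%:R * h = x + j%:R * h + h by rewrite -natr1; ring.
have c j : f (x + j.+1%:R * h) = f (x + j%:R * h).
  apply/eqP; rewrite -subr_eq0 E; apply/eqP.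
  apply: (IH (fdiff h f)) => [y|l lk]; first by rewrite -iterSr.
  by rewrite /fdiff -E !g0 ?subrr // ltnW.
elim: i => [|i IHi]; last by rewrite c.
exact: g0.
Qed.

(** Newton interpolation: a multiple of the product vanishing at the earlier nodes corrects the
    value at the next one. *)
Lemma interpolation_exists k (a : nat -> R) (f : R -> R) : injective a ->
  exists2 p : {poly R}, (size p <= k)%N & forall i, (i < k)%N -> p.[a i] = f (a i).
Proof.
move=> ainj; elim: k => [|k [p pk pE]]; first by exists 0; rewrite ?size_poly0.
pose q := \prod_(i < k) ('X - (a i)%:P).
have qa i : (i < k)%N -> q.[a i] = 0.
  by move=> ik; rewrite horner_prod (bigD1 (Ordinal ik)) //= hornerXsubC subrr mul0r.
have qk : q.[a k] != 0.
  rewrite horner_prod; apply/prodf_neq0 => i _; rewrite hornerXsubC subr_eq0.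
  by apply/eqP => /ainj ki; move: (ltn_ord i); rewrite -ki ltnn.
exists (p + ((f (a k) - p.[a k]) / q.[a k]) *: q).
  rewrite (leq_trans (size_polyD _ _)) // geq_max (leq_trans pk) //=.
  rewrite (leq_trans (size_scale_leq _ _)) // size_prod_XsubC.
  by rewrite /index_enum -enumT size_enum_ord.
move=> i; rewrite ltnS leq_eqVlt => /predU1P[->|ik].
  by rewrite hornerD hornerZ divfK // addrC subrK.
by rewrite hornerD hornerZ (qa i) // mulr0 addr0 pE.
Qed.

Lemma horner_nat_mul_eq0 p h : h != 0 -> (forall i : nat, p.[i%:R * h] = 0) -> p = 0.
Proof.
move=> h0 p0; apply/eqP; apply/negPn/negP => pn0.
have := @max_poly_roots _ p [seq i%:R * h | i <- iota 0 (size p)] pn0.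
rewrite size_map size_iota ltnn => /(_ _ _)/wrap[]//.
  by apply/allP => _ /mapP[i _ ->]; apply/rootP.
rewrite map_inj_uniq ?iota_uniq // => i j /(mulIf h0) /eqP.
by rewrite eqr_nat => /eqP.
Qed.

(* Interpolating f at 0, ..., k-1 reduces to the case where f vanishes there,
   hence on the integers; a polynomial interpolating f on the finer grid Z/m
   then has infinitely many zeros, so f vanishes on Q. *)
Lemma frechet f k : continuous f ->
  (forall h x, iter k (fdiff h) f x = 0) ->
  exists p : {poly R}, forall x, f x = p.[x].
Proof.
move=> cf fk.
have ninj : injective (fun i : nat => i%:R : R).
  by move=> i j /eqP; rewrite eqr_nat => /eqP.
have [p pk pE] := interpolation_exists k f ninj.
exists p => x; pose g := f - horner p.
have cg : continuous g.
  by move=> y; apply: continuousB; [exact: cf|exact: continuous_horner].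
have gk h y : iter k (fdiff h) g y = 0.
  by rewrite iter_fdiffB fk iter_fdiff_horner // subrr.
have g0 i : (i < k)%N -> g i%:R = 0.
  by move=> ik; rewrite /g /= !fctE pE // subrr.
have gn i : g i%:R = 0.
  rewrite -[i%:R]add0r -[i%:R]mulr1.
  by apply: (@fdiff_grid0 k) => // j jk; rewrite add0r mulr1 g0.
have gN i : g (- i%:R) = 0.
  (* Negative integers lie on the grid descending from [k] with step -1, whose first [k] points k,
     ..., 1 are known zeros. *)
  have -> : - i%:R = k%:R + (i + k)%:R * (-1) :> R by rewrite natrD; ring.
  apply: (@fdiff_grid0 k) => // j jk.
  have -> : k%:R + j%:R * -1 = (k - j)%:R :> R by rewrite natrB 1?ltnW //; ring.
  exact: gn.
have gq h : h != 0 -> forall m : nat, (forall i, g (i%:R * (m%:R * h)) = 0) ->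
    (0 < m)%N -> forall i, g (i%:R * h) = 0.
  move=> h0 m gm m0 i.
  have hinj : injective (fun i : nat => i%:R * h).
    by move=> i' j' /(mulIf h0)/ninj.
  have [q qk qE] := interpolation_exists k g hinj.
  have gqE j : g (j%:R * h) = q.[j%:R * h].
    apply/eqP; rewrite -subr_eq0; apply/eqP.
    have := @fdiff_grid0 k (g - horner q) h 0 _ _ j; rewrite add0r.
    apply => [y|l lk].
      by rewrite iter_fdiffB gk iter_fdiff_horner // subrr.
    by rewrite add0r !fctE qE // subrr.
  rewrite gqE (_ : q = 0) ?horner0 //.
  have mh : m%:R * h != 0 by rewrite mulf_neq0 // pnatr_eq0 -lt0n.
  apply: (horner_nat_mul_eq0 mh) => j.
  by rewrite mulrA -natrM -gqE natrM -mulrA gm.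
have grat (r : rat) : g (ratr r) = 0.
  have d0 : (0 < `|denq r|)%N by rewrite absz_gt0 denq_neq0.
  have dE : (denq r)%:~R = `|denq r|%:R :> R.
    by rewrite -[denq r in LHS]gez0_abs // ltW // denq_gt0.
  have dn0 : `|denq r|%:R != 0 :> R by rewrite pnatr_eq0 -lt0n.
  rewrite /ratr dE; case: (intP (numq r)) => [|n|n].
  - by rewrite mul0r (gn 0%N).
  - apply: (gq _ _ `|denq r|%N) => //; first by rewrite invr_eq0.
    by move=> i; rewrite divff // mulr1 gn.
  - rewrite mulrNz mulNr -mulrN; apply: (gq _ _ `|denq r|%N) => //.
      by rewrite oppr_eq0 invr_eq0.
    by move=> i; rewrite mulrN divff // mulrN1 gN.
suff : g x = 0 by move/eqP; rewrite /g !fctE subr_eq0 => /eqP.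
apply/eqP; apply/negPn/negP => gx.
have [||y [gy [r _ ry]]] := @dense_rat R [set y | g y != 0].
- by exists x.
- apply: (@open_comp _ _ g [set z | z != 0]); first by move=> y _; exact: cg.
  exact: open_neq.
- by move: gy; rewrite /= -ry grat eqxx.
Qed.

End differences.

(** * Uniform closure of a linear span *)

Section span_closure.
Variables (R : realType) (X I : Type) (phi : I -> X -> R) (K : set X).
Implicit Types (g : X -> R).

(** The closure, for uniform convergence on [K], of the span of the [phi i]. Coding combinations as
    lists makes their addition a concatenation. *)
Definition span_closure g := forall e : R, 0 < e ->
  exists s : seq (R * I), forall x, K x ->
    `|g x - \sum_(c <- s) c.1 * phi c.2 x| <= e.

Lemma span_closure_gen i : span_closure (phi i).
Proof.
move=> e e0; exists [:: (1, i)] => x _.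
by rewrite big_seq1 mul1r subrr normr0 ltW.
Qed.

Lemma span_closure_lim g :
  (forall e : R, 0 < e -> exists2 g', span_closure g' &
    forall x, K x -> `|g x - g' x| <= e) ->
  span_closure g.
Proof.
move=> lim e e0; have e20 : 0 < e / 2 by rewrite divr_gt0.
have [g' /(_ _ e20)[s sP] gg'] := lim _ e20; exists s => x Kx.
rewrite [e]splitr (le_trans (ler_distD (g' x) _ _)) // lerD //; first exact: gg'.
exact: sP.
Qed.

Lemma eq_span_closure g g' : (forall x, K x -> g x = g' x) ->
  span_closure g' -> span_closure g.
Proof.
move=> gg' cg'; apply: span_closure_lim => e e0; exists g' => // x Kx.
by rewrite gg' // subrr normr0 ltW.
Qed.

Lemma span_closure0 : span_closure (fun=> 0).
Proof.
by move=> e e0; exists [::] => x _; rewrite big_nil subr0 normr0 ltW.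
Qed.

Lemma span_closureZD a g1 g2 : span_closure g1 -> span_closure g2 ->
  span_closure (fun x => a * g1 x + g2 x).
Proof.
(* The tolerance for [g1] is divided by |a| + 1, as [a] may be 0. *)
move=> c1 c2 e e0; have a0 : 0 < `|a| + 1 by rewrite ltr_wpDl.
have [|s1 s1P] := c1 (e / 2 / (`|a| + 1)); first by rewrite !divr_gt0.
have [|s2 s2P] := c2 (e / 2); first by rewrite divr_gt0.
exists ([seq (a * c.1, c.2) | c <- s1] ++ s2) => x Kx.
rewrite big_cat big_map /=.
under eq_bigr do rewrite -mulrA.
rewrite -mulr_sumr.
set S1 := \sum_(c <- s1) _; set S2 := \sum_(c <- s2) _.
have -> : a * g1 x + g2 x - (a * S1 + S2) = a * (g1 x - S1) + (g2 x - S2) by ring.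
rewrite [e]splitr (le_trans (ler_normD _ _)) // lerD //; last exact: s2P.
rewrite normrM (@le_trans _ _ ((`|a| + 1) * (e / 2 / (`|a| + 1)))) //.
  by rewrite ler_pM // ?s1P // lerDl.
by rewrite mulrC divfK // gt_eqF.
Qed.

Lemma span_closureD g1 g2 : span_closure g1 -> span_closure g2 ->
  span_closure (fun x => g1 x + g2 x).
Proof.
move=> c1 c2; apply: eq_span_closure (span_closureZD 1 c1 c2) => x _.
by rewrite mul1r.
Qed.

Lemma span_closureZ a g : span_closure g -> span_closure (fun x => a * g x).
Proof.
move=> c; apply: eq_span_closure (span_closureZD a c span_closure0) => x _.
by rewrite addr0.
Qed.

Lemma span_closureB g1 g2 : span_closure g1 -> span_closure g2 ->
  span_closure (fun x => g1 x - g2 x).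
Proof.
move=> c1 c2; apply: eq_span_closure (span_closureZD (-1) c2 c1) => x _.
by rewrite mulN1r addrC.
Qed.

Lemma span_closure_sum J (s : seq J) (g : J -> X -> R) :
  (forall j, span_closure (g j)) -> span_closure (fun x => \sum_(j <- s) g j x).
Proof.
move=> cg; elim: s => [|j s IH].
  by apply: eq_span_closure span_closure0 => x _; rewrite big_nil.
apply: eq_span_closure (span_closureD (cg j) IH) => x _.
by rewrite big_cons.
Qed.

End span_closure.

(** * Change of generators and of variables *)

Section span_closure_transfer.
Variable R : realType.

Lemma span_closure_trans X I J (phi : I -> X -> R) (psi : J -> X -> R)
    (K : set X) g :
  (forall j, span_closure phi K (psi j)) -> span_closure psi K g ->
  span_closure phi K g.
Proof.
move=> cpsi cg; apply: span_closure_lim => e e0; have [s sP] := cg e e0.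
exists (fun x => \sum_(c <- s) c.1 * psi c.2 x) => //.
by apply: span_closure_sum => c; apply: span_closureZ.
Qed.

(** Used with [u] a translation, an affine map or a linear form, under which translates or neurons
    remain such. *)
Lemma span_closure_comp X Y I J (phi : I -> X -> R) (psi : J -> Y -> R)
    (K : set X) (K' : set Y) (u : Y -> X) g :
  (forall y, K' y -> K (u y)) ->
  (forall i, exists j, forall y, phi i (u y) = psi j y) ->
  span_closure phi K g -> span_closure psi K' (g \o u).
Proof.
move=> uK phiu cg; apply: (@span_closure_trans _ _ I _ (fun i => phi i \o u)).
  move=> i; have [j ij] := phiu i.
  by apply: eq_span_closure (span_closure_gen _ _ j) => y _; exact: ij.
by move=> e e0; have [s sP] := cg e e0; exists s => y /uK; exact: sP.
Qed.

End span_closure_transfer.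

(** * Monomials and the exponential as limits of univariate networks *)

Section univariate.
Variable R : realType.
Implicit Types (f g F s : R -> R) (x y h u L M : R).

Definition lip L f := forall x y, `|f x - f y| <= L * `|x - y|.

Lemma lip_ge0 L f : lip L f -> 0 <= L.
Proof.
move=> /(_ 1 0); rewrite subr0 normr1 mulr1; exact: le_trans.
Qed.

Lemma lip_continuous L f : lip L f -> continuous f.
Proof.
move=> Lf x; have L0 := lip_ge0 Lf; apply/cvgrPdist_le => e e0.
have L1 : 0 < L + 1 by rewrite ltr_wpDl.
near=> y; rewrite (le_trans (Lf x y)) //.
rewrite (@le_trans _ _ ((L + 1) * `|x - y|)) ?ler_wpM2r ?lerDl //.
rewrite mulrC -ler_pdivlMr //; near: y.
by apply: cvgr_dist_le; [exact: cvg_id|rewrite divr_gt0].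
Unshelve. all: by end_near.
Qed.

Lemma lip_fdiff L f h : lip L f -> lip (L + L) (fdiff h f).
Proof.
move=> Lf x y; rewrite /fdiff.
have -> : f (x + h) - f x - (f (y + h) - f y) =
  (f (x + h) - f (y + h)) - (f x - f y) by ring.
rewrite (le_trans (ler_normB _ _)) // mulrDl lerD //.
have -> : x - y = (x + h) - (y + h) by ring.
exact: Lf.
Qed.

Lemma lip_iter_fdiff k L f h : lip L f -> exists L', lip L' (iter k (fdiff h) f).
Proof.
move=> Lf; elim: k => [|k [L' L'f]] /=; first by exists L.
by exists (L' + L'); exact: lip_fdiff.
Qed.

(** The derivative of [fdiff h F] is [fdiff h f], bounded by L |h|. *)
Lemma lip_fdiff_antiderivative L F f h : lip L f -> antiderivative F f ->
  lip (L * `|h|) (fdiff h F).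
Proof.
move=> Lf Ff x y.
have [c _ ->] := antiderivative_MVT y x (antiderivative_fdiff h Ff).
rewrite normrM ler_wpM2r //.
have -> : `|h| = `|c + h - c| by congr (`| _ |); ring.
exact: Lf.
Qed.

(** [fdiff h F x] is the integral of [f] from x to x + h, and its Riemann sums combine translates of
    [f]. Each of the [m] pieces errs by at most L d^2 whatever [x] is, and [m] is chosen so that the
    total L h^2 / m is at most [e]. *)
Lemma riemann_sum L F f h : lip L f -> antiderivative F f ->
  span_closure (fun b x => f (x + b)) setT (fdiff h F).
Proof.
move=> Lf Ff e e0; have L0 := lip_ge0 Lf.
pose m := (Num.truncn (L * h ^+ 2 / e)).+1; pose d := h / m%:R.
have m0 : 0 < m%:R :> R by rewrite ltr0n.
have mE : m%:R * d = h by rewrite mulrC divfK // gt_eqF.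
exists [seq (d, i%:R * d) | i <- index_iota 0 m] => x _; rewrite big_map /=.
pose G i := F (x + i%:R * d).
have -> : fdiff h F x = \sum_(0 <= i < m) (G i.+1 - G i).
  by rewrite telescope_sumr // /G mul0r addr0 mE.
rewrite -sumrB (le_trans (ler_norm_sum _ _ _)) //.
rewrite (@le_trans _ _ (\sum_(0 <= i < m) L * d ^+ 2)) //; last first.
  rewrite sumr_const_nat subn0 -mulr_natl.
  have -> : m%:R * (L * d ^+ 2) = L * h ^+ 2 / m%:R.
    by rewrite /d; field; rewrite gt_eqF.
  rewrite ler_pdivrMr // [leRHS]mulrC -ler_pdivrMr //.
  exact/ltW/truncnS_gt.
apply: ler_sum => i _; rewrite /G.
have [c] := antiderivative_MVT (x + i%:R * d) (x + i.+1%:R * d) Ff.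
have -> : x + i.+1%:R * d - (x + i%:R * d) = d by rewrite -natr1; ring.
move=> cd ->.
have -> : f c * d - (d, i%:R * d).1 * f (x + (d, i%:R * d).2) =
    (f c - f (x + i%:R * d)) * d by rewrite /=; ring.
rewrite normrM -real_normK ?num_real // expr2 [leRHS]mulrA ler_wpM2r //.
by rewrite (le_trans (Lf _ _)) // ler_wpM2l.
Qed.

Lemma antiderivative_tower f : continuous f -> exists2 F : nat -> R -> R,
  F 0%N = f & forall i, antiderivative (F i.+1) (F i).
Proof.
move=> cf.
(* [A] must be total to be iterated; its value at a discontinuous [g] is arbitrary. *)
have /choice[A AP] : forall g, exists F, continuous g -> antiderivative F g.
  move=> g; have [cg|ncg] := pselect (continuous g); last by exists g.
  by have [F Fg] := antiderivative_exists cg; exists F.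
have citer i : continuous (iter i A f).
  by elim: i => // i IH; exact: antiderivative_continuous (AP _ IH).
by exists (fun i => iter i A f) => // i; exact: (AP _ (citer i)).
Qed.

(** One more difference of one more antiderivative is one more averaging, to which [riemann_sum]
    applies; the Lipschitz bound is carried along for that purpose. *)
Lemma iterated_average L (F : nat -> R -> R) h k : lip L (F 0%N) ->
  (forall i, antiderivative (F i.+1) (F i)) ->
  (exists L', lip L' (iter k (fdiff h) (F k))) /\
  span_closure (fun b x => F 0%N (x + b)) setT (iter k (fdiff h) (F k)).
Proof.
move=> LF dF; elim: k => [|k [[L' L'f] IH]] /=.
  split; first by exists L.
  apply: eq_span_closure (span_closure_gen _ _ 0) => x _.
  by rewrite addr0.
have dFk := antiderivative_iter_fdiff k h (dF k).
split; first by exists (L' * `|h|); exact: lip_fdiff_antiderivative dFk.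
apply: span_closure_trans (riemann_sum h L'f dFk) => b.
apply: (span_closure_comp (K := setT) (u := fun x => x + b)) IH => //.
by move=> b'; exists (b + b') => x; rewrite addrA.
Qed.

Definition neuron1 s (ab : R * R) (x : R) := s (ab.1 * x + ab.2).

(** As a function of t, a translate of [s] taken at x0 + j l t is a neuron of weight j l, and a
    difference of step l t raises [j] by one; hence the general [j] in the induction. *)
Lemma dilated_fdiff_closure K s g k j l x0 :
  span_closure (fun b x => s (x + b)) setT g ->
  span_closure (neuron1 s) K
    (fun t => iter k (fdiff (l * t)) g (x0 + j%:R * (l * t))).
Proof.
move=> cg; elim: k j => [|k IH] j /=.
  apply: (span_closure_comp (K := setT)
    (u := fun t => x0 + j%:R * (l * t))) cg => // b.
  by exists (j%:R * l, x0 + b) => t; congr s => /=; ring.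
apply: eq_span_closure (span_closureB (IH j.+1) (IH j)) => t _.
by rewrite /fdiff -addrA -natr1 mulrDl mul1r.
Qed.

(* For G the k-fold average (up to a factor h^k) of s over [0, h], G^(k) is the
   k-th difference of s of step h, so that at a point x0 where it is nonzero the
   k-th difference of G of step l t at x0 is close to a multiple of (l t)^k. *)
Lemma monomial_closure L s k M : lip L s -> non_polynomial s -> 0 <= M ->
  span_closure (neuron1 s) [set t | `|t| <= M] (fun t => t ^+ k).
Proof.
move=> Ls npoly M0; have cs := lip_continuous Ls.
have [h [x0 d0]] : exists h x0, iter k (fdiff h) s x0 != 0.
  apply: contrapT => no; apply: npoly; apply: (@frechet _ _ k cs) => h x.
  by apply/eqP; apply/negPn/negP => d0; apply: no; exists h, x.
set d := iter _ _ _ _ in d0.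
have [F F0 dF] := antiderivative_tower cs.
have LF : lip L (F 0%N) by rewrite F0.
have [_] := iterated_average h k LF dF; rewrite F0.
set G := iter k (fdiff h) (F k) => cG.
have [L' L's] := lip_iter_fdiff k h Ls; have L'0 := lip_ge0 L's.
apply: span_closure_lim => e e0.
(* For |t| <= M the error will be at most C l / |d|; [l] makes this at most [e], and C + 1 allows
   for C = 0. *)
pose C := L' * k%:R * M * M ^+ k.
have C0 : 0 <= C by rewrite !mulr_ge0 // exprn_ge0.
pose l := e * `|d| / (C + 1).
have l0 : 0 < l by rewrite divr_gt0 ?mulr_gt0 ?normr_gt0 // ltr_wpDl.
exists (fun t => (d * l ^+ k)^-1 * iter k (fdiff (l * t)) G (x0 + 0%:R * (l * t))).
  exact/span_closureZ/dilated_fdiff_closure.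
move=> t /= tM; rewrite mul0r addr0.
have [|c] := @iter_fdiff_MVT R k (fun i => iter k (fdiff h) (F i)) (l * t) x0.
  by move=> i _; exact: antiderivative_iter_fdiff.
rewrite -/G F0 => cx ->.
have -> : t ^+ k - (d * l ^+ k)^-1 * ((l * t) ^+ k * iter k (fdiff h) s c) =
    t ^+ k * ((d - iter k (fdiff h) s c) / d).
  have lk0 : l ^+ k != 0 by rewrite expf_neq0 // gt_eqF.
  rewrite [(l * t) ^+ k]exprMn; move: (l ^+ k) lk0 => lk lk0.
  by field; rewrite d0 lk0.
rewrite normrM normrX normf_div mulrA ler_pdivrMr ?normr_gt0 //.
apply: (@le_trans _ _ (C * l)); last first.
  by rewrite /l mulrCA -[leRHS]mulr1 ler_wpM2l ?mulr_ge0 ?(ltW e0) // ler_pdivrMr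
    ?ltr_wpDl // mul1r lerDl.
have -> : C * l = M ^+ k * (L' * (k%:R * (l * M))) by rewrite /C; ring.
rewrite ler_pM ?exprn_ge0 //; first by rewrite lerXn2r ?nnegrE.
rewrite (le_trans (L's _ _)) // ler_wpM2l // distrC (le_trans cx) //.
by rewrite ler_wpM2l // normrM gtr0_norm // ler_wpM2l // ltW.
Qed.

(** The tail at [t] is dominated term by term by the tail at [M], so the exponential series
    converges uniformly for |t| <= M. *)
Lemma exp_coeff_tail (M t : R) n : `|t| <= M ->
  `|expR t - series (exp_coeff t) n| <= expR M - series (exp_coeff M) n.
Proof.
move=> tM.
have cv x : (series (exp_coeff x) m - series (exp_coeff x) n) @[m --> \oo] -->
    expR x - series (exp_coeff x) n.
  by apply: cvgB; [exact: is_cvg_series_exp_coeff|exact: cvg_cst].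
apply: ler_cvg_to (cvg_norm (cv t)) (cv M) _.
near=> m.
have nm : (n <= m)%N by near: m; exact: nbhs_infty_ge.
rewrite !sub_series_geq // (le_trans (ler_norm_sum _ _ _)) // ler_sum // => i _.
rewrite /exp_coeff /= normf_div normrX (@ger0_norm _ i`!%:R) //.
by rewrite ler_pM2r ?invr_gt0 ?ltr0n ?fact_gt0 // lerXn2r ?nnegrE // (le_trans _ tM).
Unshelve. all: by end_near.
Qed.

Lemma expR_closure L s M : lip L s -> non_polynomial s -> 0 <= M ->
  span_closure (neuron1 s) [set t | `|t| <= M] expR.
Proof.
move=> Ls npoly M0; apply: span_closure_lim => e e0.
have [n nP] : exists n, expR M - series (exp_coeff M) n <= e.
  have /cvgrPdist_le /(_ _ e0)[n _ nP] := is_cvg_series_exp_coeff M.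
  by exists n; rewrite (le_trans (ler_norm _)) // nP /=.
exists (fun t => series (exp_coeff t) n).
  apply: (span_closure_sum _ (g := fun i t => exp_coeff t i)) => i.
  apply: eq_span_closure (span_closureZ i`!%:R^-1
    (monomial_closure i Ls npoly M0)) => t _.
  by rewrite /exp_coeff /= mulrC.
by move=> t tM; rewrite (le_trans (exp_coeff_tail n tM)).
Qed.

End univariate.

(** * Products and inverses in the closure of an algebra *)

Section span_closure_algebra.
Variables (R : realType) (X I : Type) (phi : I -> X -> R) (K : set X).
Hypothesis phi_mul : forall i j, exists k, forall x, phi i x * phi j x = phi k x.
Hypothesis phi1 : exists i, forall x, phi i x = 1.
Hypothesis phi_bounded : forall i, exists B, forall x, K x -> `|phi i x| <= B.
Local Notation sc := (span_closure phi K).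
Implicit Types (g : X -> R).

Lemma span_closure_bounded g : sc g ->
  exists2 B, 0 <= B & forall x, K x -> `|g x| <= B.
Proof.
move=> /(_ 1 ltr01)[s sP].
have [B B0 BP] : exists2 B, 0 <= B &
    forall x, K x -> `|\sum_(c <- s) c.1 * phi c.2 x| <= B.
  elim: s {sP} => [|c s [B B0 BP]].
    by exists 0 => // x _; rewrite big_nil normr0.
  have [B' B'P] := phi_bounded c.2; exists (`|c.1| * `|B'| + B).
    by rewrite addr_ge0 // mulr_ge0.
  move=> x Kx; rewrite big_cons (le_trans (ler_normD _ _)) // lerD ?BP //.
  rewrite normrM ler_wpM2l // (le_trans (B'P x Kx)) //; exact: ler_norm.
exists (1 + B); first by rewrite addr_ge0.
move=> x Kx; rewrite -(subrK (\sum_(c <- s) c.1 * phi c.2 x) (g x)).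
by rewrite (le_trans (ler_normD _ _)) // lerD ?sP ?BP.
Qed.

Lemma span_closureM g1 g2 : sc g1 -> sc g2 -> sc (fun x => g1 x * g2 x).
Proof.
(* One factor at a time is reduced to generators, the other being fixed and bounded; a second use
   with the factors exchanged leaves products of two generators. *)
have approx g g' : sc g -> sc g' -> (forall i, sc (fun x => phi i x * g' x)) ->
    sc (fun x => g x * g' x).
  move=> cg cg' phig'; apply: span_closure_lim => e e0.
  have [B B0 BP] := span_closure_bounded cg'.
  have B1 : 0 < B + 1 by rewrite ltr_wpDl.
  have [|s sP] := cg (e / (B + 1)); first by rewrite divr_gt0.
  exists (fun x => \sum_(c <- s) c.1 * (phi c.2 x * g' x)).
    by apply: span_closure_sum => c; exact: span_closureZ.
  move=> x Kx; under eq_bigr do rewrite mulrA.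
  rewrite -mulr_suml -mulrBl normrM.
  rewrite (@le_trans _ _ (e / (B + 1) * (B + 1))) //; last first.
    by rewrite divfK // gt_eqF.
  by rewrite ler_pM ?sP // (le_trans (BP x Kx)) // lerDl.
move=> c1 c2; apply: (approx _ _ c1 c2) => i.
have ci := span_closure_gen phi K i.
apply: eq_span_closure (fun x _ => mulrC _ _) _.
apply: (approx _ _ c2 ci) => j; have [k jk] := phi_mul j i.
by apply: eq_span_closure (span_closure_gen _ _ k) => x _; exact: jk.
Qed.

Lemma span_closure_cst a : sc (fun=> a).
Proof.
have [i phii] := phi1.
apply: eq_span_closure (span_closureZ a
  (span_closure_gen _ _ i)) => x _.
by rewrite phii mulr1.
Qed.

Lemma span_closureX g k : sc g -> sc (fun x => g x ^+ k).
Proof.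
move=> cg; elim: k => [|k IH]; first exact: span_closure_cst.
apply: eq_span_closure (span_closureM cg IH) => x _.
by rewrite exprS.
Qed.

(* With r = 1 - g / C in [0, 1), the inverse is the sum of the geometric series
   C^-1 * (1 + r + r^2 + ...), which converges uniformly. *)
Lemma span_closureV g c : 0 < c -> (forall x, K x -> c <= g x) -> sc g ->
  sc (fun x => (g x)^-1).
Proof.
move=> c0 cg scg; have [B B0 BP] := span_closure_bounded scg.
pose C := B + c; have C0 : 0 < C by rewrite ltr_wpDl.
pose rho := 1 - c / C.
have rho0 : 0 <= rho by rewrite subr_ge0 ler_pdivrMr // mul1r lerDr.
have rho1 : rho < 1 by rewrite ltrBlDr ltrDl divr_gt0.
apply: span_closure_lim => e e0.
(* The remainder after [m] terms is r^m / g, at most rho^m / c. *)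
have [m mP] : exists m, rho ^+ m <= e * c.
  have /cvgrPdist_le /(_ (e * c)) : rho ^+ m @[m --> \oo] --> 0.
    by apply: cvg_expr; rewrite ger0_norm.
  case; first by rewrite mulr_gt0.
  move=> m _ /(_ m (leqnn m)) /=; rewrite sub0r normrN ger0_norm ?exprn_ge0 //.
  by exists m.
exists (fun x => C^-1 * \sum_(i <- index_enum 'I_m) (1 - C^-1 * g x) ^+ i).
  apply: span_closureZ; apply: span_closure_sum => i; apply: span_closureX.
  apply: span_closureB; [exact: span_closure_cst|exact: span_closureZ].
move=> x Kx; have gx0 : 0 < g x by exact: lt_le_trans (cg x Kx).
set r := 1 - C^-1 * g x.
have r0 : 0 <= r.
  rewrite subr_ge0 mulrC ler_pdivrMr // mul1r.
  by rewrite (le_trans (ler_norm _)) // (le_trans (BP x Kx)) // lerDl ltW.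
have rrho : r <= rho by rewrite lerB // mulrC ler_wpM2l ?invr_ge0 ?cg // ltW.
have E : C^-1 * \sum_(i < m) r ^+ i = (1 - r ^+ m) / g x.
  have gE : g x = C * (1 - r) by rewrite /r; field; rewrite gt_eqF.
  have r1 : 1 - r != 0.
    by rewrite /r opprB addrC subrK mulf_neq0 ?invr_eq0 // gt_eqF.
  rewrite -opprB subrX1 -mulNr opprB gE; field.
  by rewrite r1 gt_eqF.
have -> : (g x)^-1 - C^-1 * \sum_(i <- index_enum 'I_m) r ^+ i = r ^+ m / g x.
  by rewrite E; field; rewrite gt_eqF.
rewrite ger0_norm ?divr_ge0 ?exprn_ge0 // ?(ltW gx0) //.
rewrite ler_pdivrMr // (@le_trans _ _ (rho ^+ m)) ?lerXn2r ?nnegrE //.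
by rewrite (le_trans mP) // ler_wpM2l ?cg // ltW.
Qed.

End span_closure_algebra.

(** * Density of exponentials of linear forms *)

Section exponentials.
Variables (R : realType) (n : nat).
Implicit Types (x y w : 'cV[R]_n) (K : set 'cV[R]_n).

Definition dot w x := \sum_i w i 0 * x i 0.
Definition sqdist x y := \sum_i (x i 0 - y i 0) ^+ 2.

Lemma dotDl w w' x : dot (w + w') x = dot w x + dot w' x.
Proof. by rewrite -big_split; apply: eq_bigr => i _; rewrite mxE mulrDl. Qed.

Lemma dotZl a w x : dot (a *: w) x = a * dot w x.
Proof. by rewrite mulr_sumr; apply: eq_bigr => i _; rewrite mxE mulrA. Qed.

Lemma dot0l x : dot 0 x = 0.
Proof. by rewrite /dot big1 // => i _; rewrite mxE mul0r. Qed.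

Lemma sqdistE x y : sqdist x y = dot x x - dot (2 *: x) y + dot y y.
Proof.
rewrite /sqdist /dot -sumrB -big_split; apply: eq_bigr => i _ /=.
by rewrite mxE; ring.
Qed.

Lemma dot_ge0 x : 0 <= dot x x.
Proof. by apply: sumr_ge0 => i _; rewrite -expr2 sqr_ge0. Qed.

Lemma compact_dot_bounded K w : compact K ->
  exists2 B, 0 <= B & forall x, K x -> `|dot w x| <= B.
Proof.
move=> /compact_bounded[M [_ MP]].
(* Boundedness is only given beyond [M], hence |M| + 1; the open ball used for the entries needs the
   larger |M| + 2. *)
have M1 : M < `|M| + 1 by rewrite ltr_pwDr // ler_norm.
exists (\sum_i `|w i 0| * (`|M| + 2)).
  by apply: sumr_ge0 => i _; rewrite mulr_ge0 // addr_ge0.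
move=> x Kx; have xM : `|x| <= `|M| + 1 := MP _ M1 x Kx.
rewrite (le_trans (ler_norm_sum _ _ _)) // ler_sum // => i _.
rewrite normrM ler_wpM2l // ltW //.
have : ball (0 : 'cV[R]_n) (`|M| + 2) x.
  rewrite mx_norm_ball /ball_ /= sub0r normrN (le_lt_trans xM) //.
  by rewrite ltrD2l ltr1n.
by move=> [_ /(_ i 0)]; rewrite mxE -ball_normE /ball_ /= sub0r normrN.
Qed.

Definition expdot w x := expR (dot w x).

Lemma expdot_mul w w' : exists v, forall x, expdot w x * expdot w' x = expdot v x.
Proof. by exists (w + w') => x; rewrite /expdot dotDl expRD. Qed.

Lemma expdot1 : exists w, forall x, expdot w x = 1.
Proof. by exists 0 => x; rewrite /expdot dot0l expR0. Qed.

Lemma expdot_bounded K : compact K ->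
  forall w, exists B, forall x, K x -> `|expdot w x| <= B.
Proof.
move=> cK w; have [B _ BP] := compact_dot_bounded w cK.
exists (expR B) => x Kx; rewrite ger0_norm ?expR_ge0 // ler_expR.
exact: le_trans (ler_norm _) (BP x Kx).
Qed.

Lemma finite_ball_cover K (rad : 'cV[R]_n -> R) : compact K ->
  (forall x, 0 < rad x) -> exists2 s : seq 'cV[R]_n, {in s, forall x, K x} &
    forall y, K y -> exists2 x, x \in s & ball x (rad x) y.
Proof.
rewrite compact_cover => cK rad0.
have [||D' D'K cov] := cK _ K (fun x => ball x (rad x)).
- by move=> x _; exact: ball_open.
- by move=> x Kx; exists x => //; exact: ballxx.
exists (finmap.enum_fset D') => [x xD'|y /cov[x xD' xy]]; last by exists x.
by have := D'K x xD'; rewrite inE.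
Qed.

(* A softmax partition of unity: the weight expR (beta * (r_x^2 - |x - y|^2)) of
   the node x is at most 1 outside the ball of radius r_x, and one of the weights
   is at least expR (beta * m) at each point.  Multiplying all weights by
   expR (beta * |y|^2) makes them multiples of exponentials of linear forms. *)
Lemma expdot_dense K (g : 'cV[R]_n -> R) : compact K ->
  (forall x (e : R), K x -> 0 < e ->
    exists2 r, 0 < r & forall y, K y -> ball x r y -> `|g y - g x| <= e) ->
  span_closure expdot K g.
Proof.
move=> cK cg; apply: span_closure_lim => e e0.
have e20 : 0 < e / 2 by rewrite divr_gt0.
have /choice[r rP] : forall x, exists r, 0 < r /\
    (K x -> forall y, K y -> ball x r y -> `|g y - g x| <= e / 2).
  move=> x; have [Kx|nKx] := pselect (K x); last by exists 1; split.
  by have [r r0 rP] := cg x _ Kx e20; exists r.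
have r0 x : 0 < r x by have [] := rP x.
(* In the sup-norm ball of radius r_x / d the squared Euclidean distance to x is at most n (r_x /
   d)^2 <= r_x^2 / 4, which leaves the 3/4 r_x^2 that bounds [m] below. *)
pose d : R := 2 * n.+1%:R; have d0 : 0 < d by rewrite mulr_gt0.
have [s sK cov] := finite_ball_cover (rad := fun x => r x / d) cK
  (fun x => divr_gt0 (r0 x) d0).
have [m m0 mP] : exists2 m, 0 < m & {in s, forall x, m <= 3 / 4 * r x ^+ 2}.
  elim: (s) => [|x s' [m m0 mP]]; first by exists 1.
  exists (Num.min m (3 / 4 * r x ^+ 2)).
    by rewrite lt_min m0 mulr_gt0 // exprn_gt0.
  move=> y; rewrite inE => /predU1P[->|/mP my]; first by rewrite ge_min lexx orbT.
  by rewrite ge_min my.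
have [B B0 BP] : exists2 B, 0 <= B &
    {in s, forall x, forall y, K y -> `|g y - g x| <= B}.
  have [b bP] : exists b, {in s, forall x, `|g x| <= b}.
    elim: (s) => [|x s' [b bP]]; first by exists 0.
    exists (Num.max b `|g x|) => y; rewrite inE => /predU1P[->|/bP yb].
      by rewrite le_max lexx orbT.
    by rewrite le_max yb.
  have near y : K y -> exists2 x, x \in s & `|g y - g x| <= e / 2.
    move=> Ky; have [x xs xy] := cov y Ky; exists x => //.
    apply: (rP x).2 => //; first exact: sK.
    apply: le_ball xy; rewrite ler_pdivrMr // ler_pMr // /d.
    by rewrite -natrM ler1n muln_gt0.
  exists (e / 2 + (`|b| + `|b|)); first by rewrite addr_ge0 ?(ltW e20) // addr_ge0.
  move=> x xs y Ky; have [z zs yz] := near y Ky.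
  rewrite (le_trans (ler_distD (g z) _ _)) // lerD //.
  rewrite (le_trans (ler_normB _ _)) // lerD // (le_trans (bP _ _)) //;
    exact: ler_norm.
(* This gives (e / 2) beta m = |s| B, so by expR u >= 1 + u the far nodes, each contributing at most
   [B], amount to at most e / 2 times the total weight. *)
pose beta := (size s)%:R * B * 2 / e / m.
have beta0 : 0 <= beta by rewrite !divr_ge0 ?mulr_ge0 ?(ltW e0) ?(ltW m0).
have betam : (size s)%:R * B <= e / 2 * expR (beta * m).
  rewrite (@le_trans _ _ (e / 2 * (beta * m))) //.
    by rewrite /beta le_eqVlt; apply/orP; left; apply/eqP; field; rewrite !gt_eqF.
  by rewrite ler_wpM2l ?(ltW e20) // (le_trans _ (expR_ge1Dx _)) // lerDr.
pose w x y := expR (beta * (r x ^+ 2 - dot x x)) * expdot (2 * beta *: x) y.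
pose wt x y := expR (beta * (r x ^+ 2 - sqdist x y)).
have wE x y : w x y = expR (beta * dot y y) * wt x y.
  rewrite /w /wt /expdot -!expRD; congr expR; rewrite sqdistE !dotZl; ring.
have cw x : span_closure expdot K (w x).
  by apply: span_closureZ; exact: span_closure_gen.
pose S y := \sum_(x <- s) wt x y.
have S_ge y : K y -> expR (beta * m) <= S y.
  move=> Ky; have [x xs [_ xy]] := cov y Ky.
  rewrite /S (big_rem x) //= (@le_trans _ _ (wt x y)) //; last first.
    by rewrite lerDl sumr_ge0 // => z _; exact: expR_ge0.
  rewrite ler_expR ler_wpM2l // (le_trans (mP x xs)) //.
  have : sqdist x y <= r x ^+ 2 / 4; last by lra.
  rewrite (@le_trans _ _ (\sum_(i < n) (r x / d) ^+ 2)) //.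
    apply: ler_sum => i _; have := xy i 0; rewrite -ball_normE /ball_ /= => xyi.
    rewrite -real_normK ?num_real // lerXn2r ?nnegrE //; last exact: ltW.
    by rewrite divr_ge0 // ltW.
  rewrite sumr_const card_ord -[_ *+ n]mulr_natl.
  have -> : n%:R * (r x / d) ^+ 2 = (r x ^+ 2 / 4) * (n%:R / n.+1%:R ^+ 2).
    have N0 : n.+1%:R != 0 :> R by rewrite pnatr_eq0.
    by rewrite /d; move: (n.+1%:R : R) N0 => N N0; field.
  rewrite ler_piMr ?divr_ge0 ?exprn_ge0 ?(ltW (r0 x)) //.
  rewrite ler_pdivrMr ?exprn_gt0 // mul1r -natrX ler_nat.
  by rewrite (@leq_trans n.+1) // leq_pmulr.
have S0 y : K y -> 0 < S y.
  by move=> Ky; rewrite (lt_le_trans (expR_gt0 _) (S_ge y Ky)).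
have SwE y : \sum_(x <- s) w x y = expR (beta * dot y y) * S y.
  by rewrite mulr_sumr; apply: eq_bigr => x _; exact: wE.
exists (fun y => (\sum_(x <- s) g x * w x y) * (\sum_(x <- s) w x y)^-1).
  apply: (span_closureM expdot_mul (expdot_bounded cK)).
    by apply: span_closure_sum => x; exact: span_closureZ.
  apply: (span_closureV expdot_mul expdot1 (expdot_bounded cK) (c := 1)) => //.
    move=> y Ky; rewrite SwE -[1]mulr1 ler_pM //.
      by rewrite -expR0 ler_expR mulr_ge0 // dot_ge0.
    rewrite (le_trans _ (S_ge y Ky)) // -expR0 ler_expR mulr_ge0 // ltW //.
  exact: span_closure_sum.
move=> y Ky.
have -> : (\sum_(x <- s) g x * w x y) * (\sum_(x <- s) w x y)^-1 =
    (\sum_(x <- s) wt x y * g x) / S y.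
  have -> : \sum_(x <- s) g x * w x y =
      expR (beta * dot y y) * \sum_(x <- s) wt x y * g x.
    by rewrite mulr_sumr; apply: eq_bigr => x _; rewrite wE; ring.
  by rewrite SwE; field; rewrite !gt_eqF ?expR_gt0 ?S0.
have -> : g y - (\sum_(x <- s) wt x y * g x) / S y =
    (\sum_(x <- s) wt x y * (g y - g x)) / S y.
  under [in RHS]eq_bigr do rewrite mulrBr.
  by rewrite sumrB -mulr_suml -/(S y); field; rewrite gt_eqF ?S0.
rewrite normrM normfV (gtr0_norm (S0 y Ky)) ler_pdivrMr ?S0 //.
rewrite (le_trans (ler_norm_sum _ _ _)) //.
(* A node either has |g y - g x| <= e / 2 or has weight at most 1; the sum of the two bounds covers
   both cases. *)
rewrite (@le_trans _ _ (\sum_(x <- s) (wt x y * (e / 2) + B))) //; last first.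
  rewrite big_split -mulr_suml -/(S y) /= big_const_seq count_predT iter_addr_0.
  rewrite [e in leRHS]splitr [leRHS]mulrDl [S y * _]mulrC lerD2l.
  rewrite -[_ *+ size s]mulr_natl.
  rewrite (le_trans betam) //.
  by rewrite ler_wpM2l ?S_ge // ltW.
rewrite big_seq [leRHS]big_seq; apply: ler_sum => x xs.
rewrite normrM ger0_norm ?expR_ge0 //.
have [xy|xy] := ltP (sqdist x y) (r x ^+ 2).
  rewrite (@le_trans _ _ (wt x y * (e / 2))) ?lerDl // ler_wpM2l ?expR_ge0 //.
  apply: (rP x).2 => //; first exact: sK.
  split=> // i j; rewrite ord1 -ball_normE /ball_ /=.
  rewrite -(ltr_pXn2r (n := 2)) ?nnegrE // ?(ltW (r0 x)) // real_normK ?num_real //.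
  rewrite (le_lt_trans _ xy) // /sqdist (bigD1 i) //= lerDl sumr_ge0 // => l _.
  exact: sqr_ge0.
rewrite (@le_trans _ _ B) //; last first.
  by rewrite lerDr; apply: mulr_ge0; rewrite ?expR_ge0 ?(ltW e20).
rewrite -[leRHS]mul1r ler_pM ?expR_ge0 ?BP // -expR0 ler_expR.
by rewrite mulr_ge0_le0 // subr_le0.
Qed.

End exponentials.

(** * Density of shallow networks in several variables *)

Section universal_approximation.
Variables (R : realType) (n : nat).

Definition neuron (s : R -> R) (wb : 'cV[R]_n * R) (x : 'cV[R]_n) :=
  s (dot wb.1 x + wb.2).

(** On [K] the form [dot w] stays in some [-B, B], where exp is a limit of univariate neurons;
    composing these with [dot w] gives neurons of weight a w. *)
Lemma neuron_dense L s (K : set 'cV[R]_n) (g : 'cV[R]_n -> R) :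
  lip L s -> non_polynomial s -> compact K ->
  (forall x (e : R), K x -> 0 < e ->
    exists2 r, 0 < r & forall y, K y -> ball x r y -> `|g y - g x| <= e) ->
  span_closure (neuron s) K g.
Proof.
move=> Ls npoly cK cg.
apply: span_closure_trans (expdot_dense cK cg) => w.
have [B B0 BP] := compact_dot_bounded w cK.
apply: (span_closure_comp (u := dot w) BP _ (expR_closure Ls npoly B0)) => -[a b].
by exists (a *: w, b) => y; rewrite /neuron1 /neuron dotZl.
Qed.

End universal_approximation.

(** * Shallow networks as flows of HDNNs *)

Section networks.
Variables (R : realType) (n : nat) (s : R -> R).
Local Notation state := ('cV[R]_n * 'cV[R]_n)%type.

Lemma skew_block_mx (M : 'M[R]_n) a :
  let J := a *: block_mx 0 (- M^T) M 0 in J = - J^T.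
Proof.
rewrite /= linearZ /= tr_block_mx !trmx0 linearN /= trmxK -scalerN opp_block_mx.
by rewrite !oppr0 opprK.
Qed.

Lemma trmx_mul_dot (w x : 'cV[R]_n) : w^T *m x = (dot w x)%:M.
Proof.
apply/matrixP => i j; rewrite !ord1 !mxE eqxx mulr1n.
by apply: eq_bigr => k _; rewrite !mxE.
Qed.

(* With J = h^-1 [0, -M^T; M, 0] and a term W^T sigma(...) + eta = a (w, 0)
   depending on p only, the layer fixes p and adds a M w to q. *)
Lemma neuron_layer (h b : R) (c w : 'cV[R]_n) : h != 0 ->
  exists th : hdnn_layer R n, forall z z', hdnn_step s h th z z' <->
    z' = (z.1, z.2 + neuron s (w, b) z.1 *: c).
Proof.
move=> h0.
suff [th thP] : exists th : hdnn_layer R n, forall p' q,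
    h *: (hdnn_J th *m ((hdnn_W th)^T *m
      map_mx s (hdnn_W th *m col_mx p' q + hdnn_b th) + hdnn_eta th)) =
    col_mx 0 (neuron s (w, b) p' *: c).
  exists th => -[p q] [p' q']; rewrite /hdnn_step /= thP add_col_mx addr0.
  split=> [/eq_col_mx[-> ->] //|[-> ->] //].
have Jcol (M : 'M[R]_n) a v :
    h *: ((h^-1 *: block_mx 0 (- M^T) M 0) *m (a *: col_mx v (0 : 'cV_n))) =
    col_mx 0 (a *: (M *m v)).
  rewrite -scalemxAl scalerA divff // scale1r -scalemxAr mul_block_col.
  by rewrite !mul0mx !mulmx0 !addr0 scale_col_mx scaler0.
(* For w = 0 the sigma-term is suppressed by W = 0; [eta] supplies (c, 0) and M = s(b) I the
   factor. *)
have [->|w0] := eqVneq w 0.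
  exists (@HdnnLayer R n _ 0 0 (1 *: col_mx c 0) (skew_block_mx (s b)%:M h^-1)).
  move=> p' q /=; rewrite trmx0 mul0mx add0r Jcol scale1r mul_scalar_mx.
  by rewrite /neuron /= dot0l add0r.
(* All rows of [W] are (w, 0)^T, so W^T sums 2n equal values into 2n s(w.p + b) (w, 0); then M = c
   w^T / m sends w to c / (2n). *)
pose W : 'M[R]_(n + n) := const_mx 1 *m (col_mx w 0)^T.
pose m : R := (n + n)%:R * dot w w.
have m0 : m != 0.
  rewrite mulf_neq0 //; last first.
    apply: contra w0 => /eqP ww; apply/eqP/matrixP => i j; rewrite ord1 mxE.
    have pos k : true -> 0 <= w k 0 * w k 0 by rewrite -expr2 sqr_ge0.
    have /eqP : w i 0 * w i 0 = 0 by exact: (psumr_eq0P pos ww).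
    by rewrite mulf_eq0 orbb => /eqP.
  rewrite pnatr_eq0 addn_eq0 andbb; apply: contra w0 => /eqP n0.
  by apply/eqP/matrixP => i; have := ltn_ord i; rewrite {2}n0.
exists (@HdnnLayer R n _ W (const_mx b) 0 (skew_block_mx (m^-1 *: (c *m w^T)) h^-1)).
move=> p' q /=.
have -> : W^T *m map_mx s (W *m col_mx p' q + const_mx b) + 0 =
    ((n + n)%:R * neuron s (w, b) p') *: col_mx w 0.
  rewrite addr0; have -> : map_mx s (W *m col_mx p' q + const_mx b) =
      const_mx (neuron s (w, b) p').
    rewrite /W -mulmxA tr_col_mx mul_row_col trmx0 mul0mx addr0 trmx_mul_dot.
    rewrite mul_mx_scalar; apply/matrixP => i j.
    by rewrite !mxE mulr1.
  rewrite /W trmx_mul trmxK -mulmxA.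
  have -> : (const_mx 1 : 'cV[R]_(n + n))^T *m
      const_mx (neuron s (w, b) p') =
      ((n + n)%:R * neuron s (w, b) p')%:M.
    apply/matrixP => i j; rewrite !ord1 !mxE eqxx mulr1n.
    under eq_bigr do rewrite !mxE mul1r.
    by rewrite sumr_const card_ord mulr_natl.
  by rewrite mul_mx_scalar.
rewrite Jcol -scalemxAl -mulmxA; congr col_mx.
rewrite trmx_mul_dot mul_mx_scalar !scalerA; congr (_ *: c).
rewrite mulrAC mulrC mulrA; move: m0; rewrite /m; move: (dot w w) => d.
rewrite mulf_eq0 negb_or => /andP[N0 d0].
by move: ((n + n)%:R : R) N0 => N N0; field; rewrite N0 d0.
Qed.

Fixpoint trajectory (step : nat -> state -> state) (z0 : state) (j : nat) : state :=
  if j is i.+1 then step i (trajectory step z0 i) else z0.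

Section explicit_layers.
Variables (h : R) (N : nat) (theta : 'I_N -> hdnn_layer R n).
Variable step : nat -> state -> state.
Hypothesis stepP : forall (j : 'I_N) z z',
  hdnn_step s h (theta j) z z' <-> z' = step j z.

Lemma explicit_solution z0 z : hdnn_solution s h theta z0 z <->
  z = [ffun j : 'I_N.+1 => trajectory step z0 j].
Proof.
split=> [[z00 zS]|->].
  apply/ffunP => -[j jN]; rewrite ffunE /=; elim: j jN => [|j IH] jN.
    by rewrite -z00; congr (z _); apply: val_inj.
  have jN' : (j < N)%N by [].
  have := (stepP (Ordinal jN') _ _).1 (zS (Ordinal jN')) => /=.
  have -> : lift ord0 (Ordinal jN') = Ordinal jN by apply: val_inj.
  move=> ->; congr (step j _); rewrite -(IH (ltnW jN)); congr (z _).
  exact: val_inj.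
by split=> [|j]; rewrite ?ffunE //; exact/stepP.
Qed.

Lemma explicit_well_defined : hdnn_well_defined s h theta.
Proof.
move=> z0; exists [ffun j : 'I_N.+1 => trajectory step z0 j].
by split=> [|z /explicit_solution ->//]; apply/explicit_solution.
Qed.

Lemma explicit_flow z0 : hdnn_flow s h theta z0 = trajectory step z0 N.
Proof.
apply: get_unique => [|_ [z /explicit_solution -> ->]]; last by rewrite ffunE.
exists [ffun j : 'I_N.+1 => trajectory step z0 j]; last by rewrite ffunE.
exact/explicit_solution.
Qed.

End explicit_layers.

(** One layer per neuron: p keeps the value x, which every neuron reads, while q accumulates the
    outputs. A nonempty [t] makes the step size nonzero. *)
Lemma shallow_network T (t : seq ('cV[R]_n * ('cV[R]_n * R))) :
  0 < T -> (0 < size t)%N ->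
  exists theta : 'I_(size t) -> hdnn_layer R n,
    hdnn_well_defined s (T / (size t)%:R) theta /\
    forall x, hdnn_restricted_flow s (T / (size t)%:R) theta x =
      \sum_(c <- t) neuron s c.2 x *: c.1.
Proof.
move=> T0 t0; set h := T / _.
have h0 : h != 0 by rewrite mulf_neq0 ?invr_eq0 ?pnatr_eq0 -?lt0n // gt_eqF.
have /choice[th thP] : forall c : 'cV[R]_n * ('cV[R]_n * R),
    exists th : hdnn_layer R n, forall z z', hdnn_step s h th z z' <->
      z' = (z.1, z.2 + neuron s c.2 z.1 *: c.1).
  by case=> c [w b]; exact: neuron_layer.
pose step j (z : state) : state :=
  let c := nth 0 t j in (z.1, z.2 + neuron s c.2 z.1 *: c.1).
pose theta (j : 'I_(size t)) := th (nth 0 t j).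
have stepP (j : 'I_(size t)) z z' :
  hdnn_step s h (theta j) z z' <-> z' = step j z by exact: thP.
exists theta; split; first exact: explicit_well_defined stepP.
move=> x; rewrite /hdnn_restricted_flow (explicit_flow stepP).
have trajE j : trajectory step (x, 0) j =
    (x, \sum_(0 <= i < j) neuron s (nth 0 t i).2 x *: (nth 0 t i).1).
  elim: j => [|j IH]; first by rewrite big_geq.
  by rewrite /= IH big_nat_recr.
by rewrite trajE /= [RHS](big_nth 0).
Qed.

(** The cross terms in the square of the sum are nonnegative. This reduces the Euclidean error to
    single coordinates. *)
Lemma enorm_le_sum (v : 'cV[R]_n) : enorm v <= \sum_(i < n) `|v i 0|.
Proof.
rewrite /enorm -[leRHS]ger0_norm ?sumr_ge0 // -sqrtr_sqr ler_sqrt ?sqr_ge0 //.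
suff : forall r : seq 'I_n, 0 <= \sum_(i <- r) `|v i 0| /\
    \sum_(i <- r) v i 0 ^+ 2 <= (\sum_(i <- r) `|v i 0|) ^+ 2.
  by move=> /(_ (index_enum _))[].
elim=> [|i r [S0 IH]]; first by rewrite !big_nil expr0n.
rewrite !big_cons addr_ge0 //; split=> //.
rewrite sqrrD real_normK ?num_real // -addrA lerD2l (le_trans IH) // lerDr.
by rewrite mulrn_wge0 // mulr_ge0.
Qed.

End networks.

Theorem theorem1 (R : realType) (n : nat) (T : R) (hT : 0 < T)
    (Omega : set 'cV[R]_n) (hOmega : compact Omega)
    (sigma : R -> R) (hpoly : non_polynomial sigma)
    (hlip : lipschitz_continuous sigma)
    (sigmat : R -> R) (hderiv : forall x : R, is_derive x 1 sigmat (sigma x))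
    (f : 'cV[R]_n -> 'cV[R]_n) (hf : {within Omega, continuous f})
    (eps : R) (heps : 0 < eps) :
  exists (N : nat) (theta : 'I_N -> hdnn_layer R n),
    [/\ (0 < N)%N,
        hdnn_well_defined sigma (T / N%:R) theta &
        (ereal_sup [set (enorm (f xi -
            hdnn_restricted_flow sigma (T / N%:R) theta xi))%:E | xi in Omega]
          <= eps%:E)%E].
Proof.
have [L Ls] : exists L, lip L sigma.
  have [L LP] := hlip; exists L => x y.
  exact: (LP (x, y)).
(* The [n] coordinate errors add up to at most [eps]; n + 1 allows for n = 0. *)
have e10 : 0 < eps / n.+1%:R by rewrite divr_gt0.
have /choice[S SP] : forall i : 'I_n, exists S : seq (R * ('cV[R]_n * R)),
    forall x, Omega x ->
      `|f x i 0 - \sum_(c <- S) c.1 * neuron sigma c.2 x| <= eps / n.+1%:R.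
  move=> i; apply: (neuron_dense (g := fun x => f x i 0) Ls hpoly hOmega _ e10).
  move=> x e Ox e0.
  have /subspace_continuousP/(_ x Ox) := hf.
  move=> /(_ _ (nbhsx_ballx (f x) e e0)); rewrite /= nbhs_simpl /=.
  move=> /nbhs_ballP[r /= r0 rP]; exists r => // y Oy xy.
  have [_ /(_ i 0)] := rP y xy Oy.
  by rewrite -ball_normE /ball_ /= distrC => /ltW.
(* The leading null neuron contributes 0 and ensures at least one layer; the neurons of [S i] feed
   coordinate [i] only. *)
pose t : seq ('cV[R]_n * ('cV[R]_n * R)) :=
  (0, (0, 0)) :: flatten [seq [seq (c.1 *: delta_mx i 0, c.2) | c <- S i]
    | i <- index_enum 'I_n].
have [theta [wd flow]] := shallow_network sigma hT (isT : (0 < size t)%N).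
exists (size t), theta; split => //.
apply: ge_ereal_sup => _ [x Ox <-]; rewrite lee_fin flow.
rewrite (le_trans (enorm_le_sum _)) //.
have tE i : (\sum_(c <- t) neuron sigma c.2 x *: c.1) i 0 =
    \sum_(c <- S i) c.1 * neuron sigma c.2 x.
  rewrite big_cons scaler0 add0r big_flatten big_map summxE (bigD1 i) //=.
  rewrite [X in _ + X]big1 ?addr0 => [|j ji].
    rewrite big_map summxE; apply: eq_bigr => c _.
    by rewrite !mxE !eqxx mulr1 mulrC.
  rewrite big_map summxE big1 // => c _.
  by rewrite !mxE eq_sym (negPf ji) !mulr0.
rewrite (@le_trans _ _ (\sum_(i < n) eps / n.+1%:R)) //.
  by apply: ler_sum => i _; rewrite !mxE tE; exact: SP.
rewrite sumr_const card_ord -[_ *+ n]mulr_natl mulrCA ler_piMr ?(ltW heps) //.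
by rewrite ler_pdivrMr // mul1r ler_nat.
Qed.
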